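(* Let $n\geq1$ unless another range is stated. For nonnegative integers $s_1,\dots,s_n$ write $\sigma_n=s_1+\cdots+s_n$ and $p_n(s)=\frac{\sigma_n!}{s_1!\cdots s_n!}$; all sums below are over all $n$-tuples $(s_1,\ldots,s_n)$ of nonnegative integers with $s_1+2s_2+\cdots+ns_n=n$. Then: \begin{enumerate} \item for $n\ge2$, $\sum(-1)^{\sigma_n}p_n(s)T_0^{s_1}T_1^{s_2}\cdots T_{n-1}^{s_n}=-F_{n-2}$; \item $\sum p_n(s)T_0^{s_1}T_1^{s_2}\cdots T_{n-1}^{s_n}=\left\lfloor\frac{2^n+6}{14}\right\rfloor$; \item for $n\ge2$, $\sum p_n(s)T_0^{s_1}T_2^{s_2}\cdots T_{2n-2}^{s_n}=\frac{17+\sqrt{17}}{34}\left(\frac32+\frac{\sqrt{17}}{2}\right)^{n-2}+\frac{17-\sqrt{17}}{34}\left(\frac32-\frac{\sqrt{17}}{2}\right)^{n-2}$; \item $\sum(-1)^{\sigma_n}p_n(s)T_1^{s_1}T_2^{s_2}\cdots T_n^{s_n}=-\sum_{i=0}^{\lfloor(n-2)/3\rfloor}\binom{n-2-2i}{i}$; \item for $n\ge2$, $\sum p_n(s)T_1^{s_1}T_2^{s_2}\cdots T_n^{s_n}=\sum_{i=0}^{\lfloor(2n-4)/3\rfloor}\binom{2n-4-2i}{i}$; \item $\sum(-1)^{\sigma_n}p_n(s)T_1^{s_1}T_3^{s_2}\cdots T_{2n-1}^{s_n}=-\lfloor 4\cdot 3^{n-3}\rfloor$; \item $\sum(-1)^{\sigma_n}p_n(s)T_2^{s_1}T_3^{s_2}\cdots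 T_{n+1}^{s_n}=-P_{n+2}$; \item for $n\geq4$, $\sum(-1)^{\sigma_n}p_n(s)T_3^{s_1}T_4^{s_2}\cdots T_{n+2}^{s_n}=0$; \item $\sum(-1)^{\sigma_n}p_n(s)T_3^{s_1}T_5^{s_2}\cdots T_{2n+1}^{s_n}=-2^{n-1}\sum_{i=0}^{n-1}2^{-i-\lfloor i/2\rfloor}\binom{n-1-i}{\lfloor i/2\rfloor}$; \item for $n\ge2$, $\sum(-1)^{\sigma_n}p_n(s)T_4^{s_1}T_5^{s_2}\cdots T_{n+3}^{s_n}$ equals $1$ if $n\equiv0\pmod3$, $-1$ if $n\equiv1\pmod3$, and $0$ if $n\equiv2\pmod3$; \item for $n\geq3$, $\sum(-1)^{\sigma_n}p_n(s)T_4^{s_1}T_6^{s_2}\cdots T_{2n+2}^{s_n}=-4$; \item $\sum(-1)^{\sigma_n}p_n(s)T_5^{s_1}T_6^{s_2}\cdots T_{n+4}^{s_n}=(-1)^n\sum_{i=0}^{\lfloor(n+1)/2\rfloor}\binom{n+2+i}{n+1-2i}$; \item for $n\geq3$, $\sum(-1)^{\sigma_n}p_n(s)T_5^{s_1}T_7^{s_2}\cdots T_{2n+3}^{s_n}=4\cdot(-1)^n$. \end{enumerate}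
   Context: The tribonacci numbers are $T_0=T_1=0$, $T_2=1$, $T_n=T_{n-1}+T_{n-2}+T_{n-3}$ for $n\geq3$. The Fibonacci numbers are $F_0=0$, $F_1=1$, $F_n=F_{n-1}+F_{n-2}$. The Padovan numbers are $P_0=1$, $P_1=P_2=0$, $P_n=P_{n-2}+P_{n-3}$ for $n\ge3$. In each sum the exponent $s_k$ is attached to the $k$-th term of the displayed sequence (e.g. in $T_0^{s_1}T_2^{s_2}\cdots T_{2n-2}^{s_n}$ the factor is $T_{2k-2}^{s_k}$). *)

(* Defs.v *)
From HB Require Import structures.
From mathcomp Require Import all_boot all_order all_algebra.

Set Implicit Arguments.
Unset Strict Implicit.
Unset Printing Implicit Defensive.

Import Order.TTheory GRing.Theory Num.Theory.

Local Open Scope nat_scope.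

Fixpoint trib (n : nat) : nat :=
  match n with
  | 0 | 1 => 0
  | 2 => 1
  | ((m.+1 as m1).+1 as m2).+1 => trib m2 + trib m1 + trib m
  end.

Fixpoint fib (n : nat) : nat :=
  match n with
  | 0 => 0
  | 1 => 1
  | (m.+1 as m1).+1 => fib m1 + fib m
  end.

Fixpoint padovan (n : nat) : nat :=
  match n with
  | 0 => 1
  | 1 | 2 => 0
  | ((m.+1 as m1).+1 as m2).+1 => padovan m1 + padovan m
  end.

(* An n-tuple (s_1, ..., s_n) is a function on 'I_n, with s_{k+1} stored at
   index k < n. *)

Definition sigma (n : nat) (s : 'I_n -> nat) : nat := \sum_(k < n) s k.

Definition weight (n : nat) (s : 'I_n -> nat) : nat := \sum_(k < n) k.+1 * s k.

(* The division is exact, see multinomialK. *)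
Definition multinomial (n : nat) (s : 'I_n -> nat) : nat :=
  (sigma s)`! %/ \prod_(k < n) (s k)`!.

Lemma multinomialK (n : nat) (s : 'I_n -> nat) :
  multinomial s * \prod_(k < n) (s k)`! = (sigma s)`!.
Proof.
apply: divnK; rewrite /sigma; elim: n s => [|n IHn] s; first by rewrite big_ord0.
rewrite !big_ord_recr /=; set t := \sum_(i < n) _.
rewrite -(bin_fact (leq_addl t (s ord_max))) addnK mulnC.
by apply: dvdn_mull; rewrite dvdn_pmul2l ?fact_gt0 //; apply: IHn.
Qed.

(* A tuple of weight n has all its entries at most n (leq_weight), so the sums
   below range over tuples with values in 'I_n.+1 = {0, ..., n} without loss. *)
Lemma leq_weight (n : nat) (s : 'I_n -> nat) (k : 'I_n) : s k <= weight s.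
Proof.
rewrite /weight (bigD1 k) //=.
by apply: leq_trans (leq_addr _ _); rewrite leq_pmull.
Qed.

Local Open Scope ring_scope.

(* The base of the exponent s_k is a k, for 1 <= k <= n; a 0 is not used. *)
Definition multisum (n : nat) (a : nat -> nat) : int :=
  \sum_(s : {ffun 'I_n -> 'I_n.+1} | weight (fun k => s k) == n)
    (multinomial (fun k => s k))%:Z * \prod_(k < n) (a k.+1)%:Z ^+ s k.

Definition alt_multisum (n : nat) (a : nat -> nat) : int :=
  \sum_(s : {ffun 'I_n -> 'I_n.+1} | weight (fun k => s k) == n)
    (-1) ^+ sigma (fun k => s k) * (multinomial (fun k => s k))%:Z *
      \prod_(k < n) (a k.+1)%:Z ^+ s k.

(* The sum of F i for 0 <= i <= m, which is empty when m < 0. *)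
Definition sum_upto (m : int) (F : nat -> int) : int :=
  if m is Posz p then \sum_(0 <= i < p.+1) F i else 0.

(* Main.v *)
Require Import Defs.
From HB Require Import structures.
From mathcomp Require Import all_boot all_order all_algebra.
From mathcomp Require Import zify ring lra.

Set Implicit Arguments.
Unset Strict Implicit.
Unset Printing Implicit Defensive.

Import Order.TTheory GRing.Theory Num.Theory.

Local Open Scope ring_scope.

(* Splitting off one part of each tuple (Pascal's rule for multinomials) shows
   that M_n = sum p_n(s) a_1^s_1 ... a_n^s_n satisfies M_0 = 1 and
   M_n = a_1 M_(n-1) + ... + a_n M_0; the signs (-1)^sigma_n are absorbed by
   replacing a with -a.  If a obeys a three-term linear recurrence, as do
   tribonacci numbers and their every-other-term subsequences
   (T_(n+6) = 3 T_(n+4) + T_(n+2) + T_n), then eliminating the convolution gives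
   a three-term recurrence for M_n, valid once all indices are positive.  Each
   closed form obeys the same recurrence and the same initial values. *)

(** * Multinomial coefficients when one entry is raised or lowered *)

Lemma eq_sigma n (s t : 'I_n -> nat) : s =1 t -> sigma s = sigma t.
Proof. by move=> st; apply: eq_bigr => k _; rewrite st. Qed.

Lemma eq_weight n (s t : 'I_n -> nat) : s =1 t -> weight s = weight t.
Proof. by move=> st; apply: eq_bigr => k _; rewrite st. Qed.

Lemma eq_multinomial n (s t : 'I_n -> nat) :
  s =1 t -> multinomial s = multinomial t.
Proof.
move=> st; rewrite /multinomial (eq_sigma st).
by congr (_ %/ _)%N; apply: eq_bigr => k _; rewrite st.
Qed.

Definition incr n (k : 'I_n) (s : 'I_n -> nat) : 'I_n -> nat :=
  fun i => (s i + (i == k))%N.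

Definition decr n (k : 'I_n) (s : 'I_n -> nat) : 'I_n -> nat :=
  fun i => (s i - (i == k))%N.

Lemma incr_decr n (k : 'I_n) s : (0 < s k)%N -> incr k (decr k s) =1 s.
Proof. by rewrite /incr /decr => sk i; case: eqVneq => [->|_]; lia. Qed.

Lemma decr_incr n (k : 'I_n) s : decr k (incr k s) =1 s.
Proof. by rewrite /incr /decr => i; lia. Qed.

Lemma sigma_incr n (k : 'I_n) s : sigma (incr k s) = (sigma s).+1.
Proof.
rewrite /sigma /incr big_split /= -addn1; congr (_ + _)%N.
by rewrite -big_mkcond /= big_pred1_eq.
Qed.

Lemma weight_incr n (k : 'I_n) s : weight (incr k s) = (weight s + k.+1)%N.
Proof.
rewrite /weight /incr (eq_bigr _ (fun i _ => mulnDr _ _ _)) big_split /=.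
congr (_ + _)%N; rewrite (bigD1 k) //= eqxx muln1 big1 ?addn0 // => i /negbTE ->.
by rewrite muln0.
Qed.

Lemma prod_fact_incr n (k : 'I_n) s :
  (\prod_(i < n) (incr k s i)`! = (s k).+1 * \prod_(i < n) (s i)`!)%N.
Proof.
rewrite (bigD1 k) //= [in RHS](bigD1 k) //= mulnA -factS /incr eqxx addn1.
by congr (_ * _)%N; apply: eq_bigr => i /negbTE ->; rewrite addn0.
Qed.

Lemma prod_exp_incr n (k : 'I_n) s (b : nat -> int) :
  \prod_(i < n) b i.+1 ^+ incr k s i = b k.+1 * \prod_(i < n) b i.+1 ^+ s i.
Proof.
rewrite (bigD1 k) //= [in RHS](bigD1 k) //= mulrA -exprS /incr eqxx addn1.
by congr (_ * _); apply: eq_bigr => i /negbTE ->; rewrite addn0.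
Qed.

(** Once multiplied by the product of the factorials of the entries, the summand at [k] becomes
    [s k] times the factorial of [sigma s - 1], and these add up to the factorial of [sigma s]. *)
Lemma multinomial_pascal n (s : 'I_n -> nat) : (0 < sigma s)%N ->
  multinomial s = (\sum_(k < n | 0 < s k) multinomial (decr k s))%N.
Proof.
move=> s_gt0; have P_gt0 : (0 < \prod_(i < n) (s i)`!)%N.
  by apply: prodn_gt0 => i; apply: fact_gt0.
apply/eqP; rewrite -(eqn_pmul2r P_gt0) multinomialK big_distrl /=; apply/eqP.
transitivity (\sum_(k < n) s k * (sigma s).-1`!)%N.
  by rewrite -big_distrl /= -/(sigma s); case: sigma s_gt0 => // m _; rewrite factS.
rewrite (bigID (fun k => (0 < s k)%N)) /= [X in (_ + X)%N]big1 => [|k]; last first.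
  by rewrite lt0n negbK => /eqP ->.
rewrite addn0; apply: eq_bigr => k sk; have e := incr_decr sk.
rewrite -(eq_sigma e) sigma_incr /= -multinomialK.
rewrite -[in RHS](eq_bigr _ (fun i _ => congr1 factorial (e i))) prod_fact_incr.
have -> : ((decr k s k).+1 = s k) by rewrite /decr eqxx; lia.
by rewrite mulnCA.
Qed.

Lemma sigma_gt0 n (s : 'I_n -> nat) : (0 < weight s)%N -> (0 < sigma s)%N.
Proof.
rewrite !lt0n; apply: contra_neq; rewrite /weight /sigma => /eqP.
rewrite sum_nat_eq0 => /forallP s0.
by apply: big1 => k _; rewrite (eqP (s0 k)) muln0.
Qed.

(** * Convolution recurrence for the weighted sums *)

Definition vals N (s : {ffun 'I_N -> 'I_N.+1}) : 'I_N -> nat := fun k => s k.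

(* Keeping the dimension [N] apart from the weight [m] lets the recurrence below
   relate sums over one and the same index type. *)
Definition wsum (N m : nat) (b : nat -> int) : int :=
  \sum_(s : {ffun 'I_N -> 'I_N.+1} | weight (vals s) == m)
    (multinomial (vals s))%:Z * \prod_(k < N) b k.+1 ^+ vals s k.

(** Lowering the entry at [k] is a bijection onto the tuples of weight [m - k.+1] and takes one
    factor [b k.+1] out of the product. For [k >= m] no tuple qualifies. *)
Lemma wsum_decr N m (k : 'I_N) b : (m <= N)%N ->
  \sum_(s : {ffun 'I_N -> 'I_N.+1} | (weight (vals s) == m) && (0 < vals s k)%N)
    (multinomial (decr k (vals s)))%:Z * \prod_(i < N) b i.+1 ^+ vals s i =
  if (k < m)%N then b k.+1 * wsum N (m - k.+1) b else 0.
Proof.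
move=> mN; case: ltnP => km; last first.
  rewrite big1 // => s /andP[/eqP ws sk].
  have := weight_incr k (decr k (vals s)).
  by rewrite (eq_weight (incr_decr sk)) ws; lia.
pose up (s : {ffun 'I_N -> 'I_N.+1}) : {ffun 'I_N -> 'I_N.+1} :=
  [ffun i => inord (incr k (vals s) i)].
pose down (s : {ffun 'I_N -> 'I_N.+1}) : {ffun 'I_N -> 'I_N.+1} :=
  [ffun i => inord (decr k (vals s) i)].
have downE s : vals (down s) =1 decr k (vals s).
  by move=> i; rewrite {1}/vals ffunE inordK // ltnS (leq_trans (leq_subr _ _)) // -ltnS ltn_ord.
(* An entry equal to [N] cannot be raised within ['I_N.+1], where [inord] would return a default;
   hence the side condition. *)
have upE s : (vals s k < N)%N -> vals (up s) =1 incr k (vals s).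
  move=> sk i; rewrite {1}/vals ffunE inordK // ltnS /incr.
  by case: eqVneq => [->|_]; rewrite ?addn1 ?addn0 // -ltnS ltn_ord.
rewrite (reindex_onto up down) /= => [|s /andP[_ sk]]; last first.
  apply/ffunP=> i; rewrite ffunE -[RHS]inord_val; congr inord.
  by rewrite /incr downE; apply: incr_decr.
rewrite /wsum big_distrr /=; apply: eq_big => [s|s].
  have [sk|sk] := ltnP (vals s k) N.
    have -> : down (up s) == s.
      apply/eqP/ffunP=> i; apply/val_inj/(etrans (downE _ i)).
      by rewrite /decr upE //; apply: decr_incr.
    rewrite (eq_weight (upE _ sk)) weight_incr upE // /incr eqxx addn1 !andbT.
    lia.
  (* If the entry at [k] is [N], both conditions fail: the weight would exceed [m - k.+1], and no
     value of [down] reaches [N] at [k]. *)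
  transitivity false; last first.
    by apply/esym/eqP => ws; have := leq_weight (vals s) k; rewrite ws; lia.
  apply/negP => /andP[/andP[_ uk]] /eqP/(congr1 (fun t => vals t k)).
  by rewrite downE /decr eqxx; have := ltn_ord (up s k); rewrite -/(vals _ k); lia.
case/andP=> /andP[ws uk] /eqP dus.
have sk : (vals s k < N)%N.
  by rewrite -dus downE /decr eqxx; have := ltn_ord (up s k); rewrite -/(vals _ k); lia.
have e := upE _ sk; have e' : decr k (vals (up s)) =1 vals s.
  by move=> i; rewrite -[RHS](decr_incr k (vals s)) /decr e.
rewrite (eq_multinomial e') mulrCA; congr (_ * _).
by rewrite -prod_exp_incr; apply: eq_bigr => i _; rewrite e.
Qed.

(** Pascal's rule splits each multinomial over the positions with a positive entry; exchanging the
    sums leaves, for each [k], the sum computed in [wsum_decr]. *)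
Lemma wsum_rec N m b : (m < N)%N ->
  wsum N m.+1 b = \sum_(k < m.+1) b k.+1 * wsum N (m - k) b.
Proof.
move=> mN; rewrite (big_ord_widen N (fun k => b k.+1 * wsum N (m - k) b)) //.
rewrite big_mkcond /=.
under [RHS]eq_bigr => k _ do rewrite -subSS -(wsum_decr _ _ mN).
rewrite (exchange_big_dep (fun s : {ffun 'I_N -> 'I_N.+1} =>
  weight (vals s) == m.+1)) /= => [|k s _ /andP[]//].
apply: eq_bigr => s /eqP ws; rewrite -big_distrl /= ws eqxx /=; congr (_ * _).
have s_gt0 : (0 < sigma (vals s))%N by rewrite sigma_gt0 ?ws.
by rewrite (multinomial_pascal s_gt0) (big_morph Posz PoszD (erefl _)).
Qed.

Lemma wsum0 N b : wsum N 0 b = 1.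
Proof.
rewrite /wsum (bigD1 [ffun=> ord0]) /=; last first.
  by apply/eqP/big1 => k _; rewrite /vals ffunE muln0.
rewrite [X in _ + X]big1 ?addr0 => [|s /andP[/eqP ws /eqP s0]]; last first.
  case: s0; apply/ffunP => k; apply/val_inj; rewrite ffunE /=; apply/eqP.
  by rewrite -leqn0 -ws; apply: (leq_weight (vals s)).
rewrite [X in _ * X]big1 => [|k _]; last by rewrite /vals ffunE.
rewrite /multinomial /sigma !big1 // => k _; by rewrite /vals ffunE.
Qed.

(** The coefficients in [wsum_rec] are the same for every dimension, so strong induction on [m]
    applies. *)
Lemma wsum_diag N m b : (m <= N)%N -> wsum N m b = wsum m m b.
Proof.
elim/ltn_ind: m N => -[|m] IH N mN; first by rewrite !wsum0.
rewrite !wsum_rec //; apply: eq_bigr => k _.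
have mk : (m - k <= m)%N by apply: leq_subr.
by rewrite !(IH (m - k)%N) ?ltnS ?(leq_trans mk) // ltnW.
Qed.

(** * Three-term recurrences from the convolution *)

Definition msum n b := wsum n n b.

Lemma msum0 b : msum 0 b = 1. Proof. exact: wsum0. Qed.

Lemma msumS n b : msum n.+1 b = \sum_(k < n.+1) b k.+1 * msum (n - k) b.
Proof.
rewrite /msum wsum_rec //; apply: eq_bigr => k _.
by rewrite wsum_diag // (leq_trans (leq_subr _ _)).
Qed.

Lemma multisumE n a : multisum n a = msum n (fun k => (a k)%:Z).
Proof. by []. Qed.

Lemma alt_multisumE n a : alt_multisum n a = msum n (fun k => - (a k)%:Z).
Proof.
apply: eq_bigr => s _; rewrite [_ ^+ _ * _]mulrC -mulrA; congr (_ * _).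
rewrite /sigma expr_sum -big_split; apply: eq_bigr => k _ /=.
by rewrite -exprMn mulN1r.
Qed.

(** A convolution with [b] shifted by [j] is the full one for [msum (n + j).+1] without its first
    [j] terms. Summing the recurrence of [b] against [msum (n - k) b] thus relates four consecutive
    values, and the missing terms supply the corrections to [r1], [r2], [r3]. *)
Lemma msum_linrec n b r1 r2 r3 :
    (forall k, b k.+4 = r1 * b k.+3 + r2 * b k.+2 + r3 * b k.+1) ->
  msum n.+4 b = (r1 + b 1%N) * msum n.+3 b + (r2 + b 2%N - r1 * b 1%N) * msum n.+2 b
              + (r3 + b 3%N - r1 * b 2%N - r2 * b 1%N) * msum n.+1 b.
Proof.
move=> br; have tail j : \sum_(k < n.+1) b (k.+1 + j)%N * msum (n - k) b =
    msum (n + j).+1 b - \sum_(k < j) b k.+1 * msum (n + j - k) b.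
  rewrite msumS -addSn [in RHS]addnC big_split_ord /=.
  rewrite [in RHS]addrAC subrr add0r; apply: eq_bigr => k _.
  by congr (b _ * msum _ _); lia.
have : \sum_(k < n.+1) b (k.+1 + 3)%N * msum (n - k) b =
    r1 * (\sum_(k < n.+1) b (k.+1 + 2)%N * msum (n - k) b)
  + r2 * (\sum_(k < n.+1) b (k.+1 + 1)%N * msum (n - k) b)
  + r3 * (\sum_(k < n.+1) b (k.+1 + 0)%N * msum (n - k) b).
  rewrite !mulr_sumr -!big_split; apply: eq_bigr => k _ /=.
  by rewrite addn3 addn2 addn1 addn0 br !mulrDl !mulrA.
rewrite !tail !big_ord_recr !big_ord0 /= !(addn0, addn1, addn2, addn3).
by rewrite !subSS !subn0 => /(canRL (subrK _)) ->; ring.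
Qed.

Lemma msum1 b : msum 1 b = b 1%N.
Proof. by rewrite msumS big_ord1 msum0 mulr1. Qed.

Lemma msum2 b : msum 2 b = b 1%N ^+ 2 + b 2%N.
Proof. by rewrite msumS !big_ord_recr big_ord0 /= msum1 msum0; ring. Qed.

Lemma msum3 b : msum 3 b = b 1%N ^+ 3 + 2 * b 1%N * b 2%N + b 3%N.
Proof. by rewrite msumS !big_ord_recr big_ord0 /= msum2 msum1 msum0; ring. Qed.

Lemma linrec_eq (A : pzRingType) (x y z : A) (f g : nat -> A) :
    (forall n, f n.+3 = x * f n.+2 + y * f n.+1 + z * f n) ->
    (forall n, g n.+3 = x * g n.+2 + y * g n.+1 + z * g n) ->
  f 0%N = g 0%N -> f 1%N = g 1%N -> f 2%N = g 2%N -> f =1 g.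
Proof.
move=> fr gr e0 e1 e2 n.
suff [] : [/\ f n = g n, f n.+1 = g n.+1 & f n.+2 = g n.+2] by [].
by elim: n => [|n [en en1 en2]]; split; rewrite // fr gr en en1 en2.
Qed.

(** * Tribonacci recurrences and the resulting closed forms *)

Lemma tribSSS n : trib n.+3 = (trib n.+2 + trib n.+1 + trib n)%N.
Proof. by []. Qed.

Lemma trib_skip n :
  trib n.+4.+2 = (3 * trib n.+4 + trib n.+2 + trib n)%N.
Proof.
rewrite [trib n.+4.+2]tribSSS (tribSSS n.+2) (tribSSS n.+1) (tribSSS n).
lia.
Qed.

(** In the uses below [e] is the sign, 1 for plain and -1 for alternating sums, and [trib j] is the
    base of the first exponent. *)
Lemma msum_trib e j b n : (forall k, b k.+1 = e * (trib (k + j))%:Z) ->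
  msum n.+4 b = (1 + b 1%N) * msum n.+3 b + (1 + b 2%N - b 1%N) * msum n.+2 b
              + (1 + b 3%N - b 2%N - b 1%N) * msum n.+1 b.
Proof.
move=> be; rewrite (@msum_linrec n b 1%N 1 1) ?mul1r // => k.
by rewrite !be !addSn tribSSS !PoszD; ring.
Qed.

Lemma msum_trib_skip e j b n : (forall k, b k.+1 = e * (trib (2 * k + j))%:Z) ->
  msum n.+4 b = (3 + b 1%N) * msum n.+3 b + (1 + b 2%N - 3 * b 1%N) * msum n.+2 b
              + (1 + b 3%N - 3 * b 2%N - b 1%N) * msum n.+1 b.
Proof.
move=> be; rewrite (@msum_linrec n b 3%N 1 1) ?mul1r // => k.
rewrite !be !mulnS !add2n !addSn; move: (2 * k + j)%N => m.
by have := trib_skip m; lia.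
Qed.

Lemma alt_multisum_trib_shift1 n :
  alt_multisum n.+2 (fun k => trib (k - 1)) = - (fib n)%:Z.
Proof.
rewrite alt_multisumE; set b := (b in msum _ b).
have rec m : msum m.+4 b = 1 * msum m.+3 b + 1 * msum m.+2 b + 0 * msum m.+1 b.
  by apply: (@msum_trib (-1) 0) => k; rewrite /b subn1 addn0 mulN1r.
apply: (@linrec_eq _ 1 1 0 (fun n => msum n.+2 b) (fun n => - (fib n)%:Z) _ _ _ _ _ n)
  => [m|m|||].
- exact: rec.
- by rewrite /= !PoszD; ring.
- by rewrite msum2.
- by rewrite msum3.
by rewrite rec msum3 msum2 msum1.
Qed.

(** These residues fix the remainder in [(2 ^ n + 6) %/ 14], making the floor linear in the power of
    2 in each of three cases. *)
Lemma expn2_mod7 n : (2 ^ n %% 7 \in [:: 1; 2; 4])%N.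
Proof.
elim: n => // n; rewrite expnS -modnMmr !inE.
by case/or3P => /eqP ->.
Qed.

Lemma multisum_trib_shift1 n :
  multisum n.+1 (fun k => trib (k - 1)) = ((2 ^ n.+1 + 6) %/ 14)%N%:Z.
Proof.
rewrite multisumE; set b := (b in msum _ b).
have rec m : msum m.+4 b = 1 * msum m.+3 b + 1 * msum m.+2 b + 2 * msum m.+1 b.
  by apply: (@msum_trib 1 0) => k; rewrite /b subn1 addn0 mul1r.
apply: (@linrec_eq _ 1 1 2 (fun n => msum n.+1 b)
  (fun n => ((2 ^ n.+1 + 6) %/ 14)%N%:Z) _ _ _ _ _ n) => [m|m|||].
- exact: rec.
- rewrite !expnS; have := expn2_mod7 m; rewrite !inE.
  by move: (2 ^ m)%N => p; lia.
- by rewrite msum1.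
- by rewrite msum2.
by rewrite msum3.
Qed.

Lemma multisum_trib_even (R : rcfType) n (s := Num.sqrt 17 : R) :
  (multisum n.+2 (fun k => trib (2 * k - 2)))%:~R =
    (17 + s) / 34 * (3 / 2 + s / 2) ^+ n + (17 - s) / 34 * (3 / 2 - s / 2) ^+ n.
Proof.
rewrite multisumE; set b := (b in msum _ b).
have rec m : msum m.+4 b = 3 * msum m.+3 b + 2 * msum m.+2 b + 0 * msum m.+1 b.
  by apply: (@msum_trib_skip 1 0) => k; rewrite /b mulnS add2n subn2 addn0 mul1r.
have s2 : s ^+ 2 = 17 by rewrite sqr_sqrtr ?ler0n.
(* The third coefficient of [rec] vanishes, leaving the characteristic equation [x ^ 2 = 3 * x + 2],
   with roots [(3 + s) / 2] and [(3 - s) / 2]. *)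
have char t : t ^+ 2 = 17 -> (3 / 2 + t / 2) ^+ 2 = 3 * (3 / 2 + t / 2) + 2 :> R.
  by move=> t2; lra.
apply: (@linrec_eq R 3 2 0 (fun n => (msum n.+2 b)%:~R) (fun n =>
    (17 + s) / 34 * (3 / 2 + s / 2) ^+ n + (17 - s) / 34 * (3 / 2 - s / 2) ^+ n)
  _ _ _ _ _ n).
- by move=> m; rewrite rec !rmorphD !rmorphM.
- move=> m; rewrite !exprS -[RHS]addr0.
  have := char s s2; have := char (- s); rewrite sqrrN mulNr => /(_ s2).
  move: (3 / 2 - s / 2) (3 / 2 + s / 2) => u v u2 v2.
  rewrite (_ : u * (u * (u * _)) = u * (u ^+ 2 * u ^+ m)); last by ring.
  rewrite (_ : v * (v * (v * _)) = v * (v ^+ 2 * v ^+ m)); last by ring.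
  by rewrite u2 v2; ring.
- by rewrite msum2 !expr0 (_ : _%:~R = 1) //; lra.
- rewrite msum3 !expr1 (_ : _%:~R = 2) //.
  by lra.
rewrite rec msum3 msum2 msum1 -mulNr !char ?sqrrN // (_ : _%:~R = 8) //.
by lra.
Qed.

(** Counts compositions of [m] into parts 1, each weighted by [y], and [i] parts 3; the generating
    function is [1 / (1 - y x - x^3)]. Terms with [m < 3 * i] are zero. *)
Definition bin_sum (y : int) (m : nat) : int :=
  \sum_(i < m.+1) y ^+ (m - 3 * i) * ('C(m - 2 * i, i))%:Z.

(** The vanishing terms make the upper limit adjustable, so that sums for different [m] can be
    matched term by term. *)
Lemma bin_sumE y m K : (m < 3 * K)%N ->
  bin_sum y m = \sum_(i < K) y ^+ (m - 3 * i) * ('C(m - 2 * i, i))%:Z.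
Proof.
pose F i : int := y ^+ (m - 3 * i) * ('C(m - 2 * i, i))%:Z.
have F0 i : (m < 3 * i)%N -> F i = 0 by move=> mi; rewrite /F bin_small ?mulr0 //; lia.
suff widen K1 K2 : (m < 3 * K1)%N -> (K1 <= K2)%N ->
    \sum_(i < K1) F i = \sum_(i < K2) F i.
  by move=> mK; case: (leqP K m.+1) => Km; [apply/esym|]; apply: widen; lia.
move=> mK K12; rewrite (big_ord_widen K2 F) // big_mkcond.
by apply: eq_bigr => i _; case: ltnP => // iK; rewrite F0 //; lia.
Qed.

(** Pascal's rule on the terms of positive index; combinatorially, the last part is 1 or 3. *)
Lemma bin_sumSSS y m : bin_sum y m.+3 = y * bin_sum y m.+2 + bin_sum y m.
Proof.
rewrite (@bin_sumE y m m.+1) ?(@bin_sumE y _ m.+2); try lia.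
rewrite [in LHS]big_ord_recl [in RHS]big_ord_recl mulrDr mulr_sumr -addrA.
congr (_ + _); first by rewrite !muln0 !subn0 !bin0 exprS mulrA.
rewrite -big_split; apply: eq_bigr => i _ /=; rewrite /bump add1n !mulnS.
(* If [m < 2 * i], the subtractions truncate, but all the binomials are zero. *)
have [im|mi] := leqP (2 * i) m; last by rewrite !bin_small ?mulr0 ?addr0 //; lia.
rewrite (_ : m.+3 - (2 + 2 * i) = (m - 2 * i).+1)%N; last by lia.
rewrite (_ : m.+2 - (2 + 2 * i) = m - 2 * i)%N; last by lia.
rewrite (_ : m.+3 - (3 + 3 * i) = m - 3 * i)%N; last by lia.
rewrite binS PoszD mulrDr; congr (_ + _).
(* The exponents match only if [3 * i < m]; otherwise the binomial is zero. *)
have [im'|mi'] := ltnP (3 * i) m; last by rewrite bin_small ?mulr0 //; lia.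
by rewrite mulrA -exprS; congr (y ^+ _ * _); lia.
Qed.

Lemma sum_upto_bin m k : k = (m %/ 3)%N :> int ->
  sum_upto k (fun i => ('C(m - 2 * i, i))%:Z) = bin_sum 1 m.
Proof.
move=> ->; rewrite /sum_upto big_mkord (@bin_sumE _ _ (m %/ 3).+1); last first.
  by have := ltn_ceil m (isT : 0 < 3)%N; lia.
by apply: eq_bigr => i _; rewrite expr1n mul1r.
Qed.

Lemma alt_multisum_trib n :
  alt_multisum n.+2 (fun k => trib k) = - bin_sum 1 n.
Proof.
rewrite alt_multisumE; set b := (b in msum _ b).
have rec m : msum m.+4 b = 1 * msum m.+3 b + 0 * msum m.+2 b + 1 * msum m.+1 b.
  by apply: (@msum_trib (-1) 1) => k; rewrite /b addn1 mulN1r.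
apply: (@linrec_eq _ 1 0 1 (fun n => msum n.+2 b) (fun n => - bin_sum 1 n)
  _ _ _ _ _ n) => [m|m|||].
- exact: rec.
- by rewrite bin_sumSSS; ring.
- by rewrite msum2 /bin_sum !big_ord_recr big_ord0.
- by rewrite msum3 /bin_sum !big_ord_recr big_ord0.
by rewrite rec msum3 msum2 msum1 /bin_sum !big_ord_recr big_ord0.
Qed.

(** If [x^3 = x^2 + 1], then [y = x^2] satisfies [y^3 = y^2 + 2 y + 1]; this is why the doubled
    index appears. *)
Lemma multisum_trib n :
  multisum n.+2 (fun k => trib k) = bin_sum 1 (2 * n).
Proof.
rewrite multisumE; set b := (b in msum _ b).
have rec m : msum m.+4 b = 1 * msum m.+3 b + 2 * msum m.+2 b + 1 * msum m.+1 b.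
  by apply: (@msum_trib 1 1) => k; rewrite /b addn1 mul1r.
apply: (@linrec_eq _ 1 2 1 (fun n => msum n.+2 b) (fun n => bin_sum 1 (2 * n))
  _ _ _ _ _ n) => [m|m|||].
- exact: rec.
- by rewrite !mulnS !add2n !bin_sumSSS; ring.
- by rewrite msum2 /bin_sum !big_ord_recr big_ord0.
- by rewrite msum3 /bin_sum !big_ord_recr big_ord0.
by rewrite rec msum3 msum2 msum1 /bin_sum !big_ord_recr big_ord0.
Qed.

Lemma alt_multisum_trib_odd n :
  alt_multisum n.+3 (fun k => trib (2 * k - 1)) = - (4 * 3 ^+ n).
Proof.
rewrite alt_multisumE; set b := (b in msum _ b).
have rec m : msum m.+4 b = 3 * msum m.+3 b + 0 * msum m.+2 b + 0 * msum m.+1 b.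
  apply: (@msum_trib_skip (-1) 1) => k.
  by rewrite /b mulnS add2n subSS subn0 addn1 mulN1r.
elim: n => [|n IH]; first by rewrite msum3.
by rewrite rec IH exprS; ring.
Qed.

Lemma floor_pow3 n :
  Num.floor (4 * 3 ^ (n.+3%:Z - 3) : rat) = 4 * 3 ^+ n.
Proof.
have -> : n.+3%:Z - 3 = n by lia.
by rewrite -exprnP -(intrKfloor (R := rat) (4 * 3 ^+ n)) rmorphM rmorphXn.
Qed.

Lemma alt_multisum_trib_shift n :
  alt_multisum n.+1 (fun k => trib (k + 1)) = - (padovan n.+3)%:Z.
Proof.
rewrite alt_multisumE; set b := (b in msum _ b).
have rec m : msum m.+4 b = 0 * msum m.+3 b + 1 * msum m.+2 b + 1 * msum m.+1 b.
  by apply: (@msum_trib (-1) 2) => k; rewrite /b addn1 addn2 mulN1r.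
apply: (@linrec_eq _ 0 1 1 (fun n => msum n.+1 b) (fun n => - (padovan n.+3)%:Z)
  _ _ _ _ _ n) => [m|m|||].
- exact: rec.
- have -> : padovan m.+3.+3 = (padovan m.+4 + padovan m.+3)%N by [].
  by rewrite PoszD; ring.
- by rewrite msum1.
- by rewrite msum2.
by rewrite msum3.
Qed.

(** With first bases -1, -2, -4 all three coefficients of the recurrence cancel. *)
Lemma alt_multisum_trib_shift2 n : alt_multisum n.+4 (fun k => trib (k + 2)) = 0.
Proof.
rewrite alt_multisumE; set b := (b in msum _ b).
suff -> : msum n.+4 b = 0 * msum n.+3 b + 0 * msum n.+2 b + 0 * msum n.+1 b.
  by rewrite !mul0r.
by apply: (@msum_trib (-1) 3) => k; rewrite /b addSnnS mulN1r.
Qed.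

(** The two summands are the even-index and odd-index parts of the target sum, see
    [bin_sum_half]. *)
Lemma alt_multisum_trib_odd1 n :
  alt_multisum n.+2 (fun k => trib (2 * k + 1)) =
    - (bin_sum 2 n.+1 + bin_sum 2 n).
Proof.
rewrite alt_multisumE; set b := (b in msum _ b).
have rec m : msum m.+4 b = 2 * msum m.+3 b + 0 * msum m.+2 b + 1 * msum m.+1 b.
  apply: (@msum_trib_skip (-1) 3) => k.
  by rewrite /b mulnS addnAC addnC mulN1r.
apply: (@linrec_eq _ 2 0 1 (fun n => msum n.+2 b)
  (fun n => - (bin_sum 2 n.+1 + bin_sum 2 n)) _ _ _ _ _ n) => [m|m|||].
- exact: rec.
- by rewrite !bin_sumSSS; ring.
- by rewrite msum2 /bin_sum !big_ord_recr !big_ord0.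
- by rewrite msum3 /bin_sum !big_ord_recr !big_ord0.
by rewrite rec msum3 msum2 msum1 /bin_sum !big_ord_recr !big_ord0.
Qed.

Lemma sum_even_odd (V : nmodType) (F : nat -> V) K :
  \sum_(i < 2 * K) F i = \sum_(j < K) (F (2 * j)%N + F (2 * j).+1).
Proof.
elim: K => [|K IH]; first by rewrite muln0 !big_ord0.
by rewrite mulnS add2n !big_ord_recr /= IH addrA.
Qed.

(** Index [2 * j] gives the [j]-th term of [bin_sum 2 n.+1], and index [2 * j + 1] the [j]-th term
    of [bin_sum 2 n]. *)
Lemma bin_sum_half n :
  2 ^+ n.+1 * (\sum_(0 <= i < n.+2)
    2 ^ (- i%:Z - (i %/ 2)%N%:Z) * ('C(n.+1 - i, i %/ 2))%:R) =
  (bin_sum 2 n.+1 + bin_sum 2 n)%:~R :> rat.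
Proof.
pose F (i : nat) : rat :=
  2 ^+ n.+1 * (2 ^ (- i%:Z - (i %/ 2)%N%:Z) * ('C(n.+1 - i, i %/ 2))%:R).
rewrite mulr_sumr big_mkord.
(* The range is extended to an even length; the added binomials are zero. *)
transitivity (\sum_(i < 2 * n.+2) F i).
  rewrite (big_ord_widen (2 * n.+2) F); last by lia.
  rewrite big_mkcond; apply: eq_bigr => i _; case: ltnP => // ni.
  by rewrite /F bin_small ?mulr0 //; lia.
(* Trades a possibly negative exponent for the natural [a - b]; where that would truncate, the
   binomial vanishes. *)
have term (a b c k : nat) (z : int) : (n.+1%:Z + z = a%:Z - b%:Z \/ (c < k)%N) ->
    ((k <= c)%N -> (b <= a)%N) ->
    2 ^+ n.+1 * (2 ^ z * ('C(c, k))%:R) =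
    (2 ^+ (a - b) * ('C(c, k))%:Z)%:~R :> rat.
  have [ck|kc] := ltnP c k; first by rewrite bin_small // !mulr0.
  case=> // e /(_ isT) ba.
  rewrite mulrA exprnP -expfzDr // e subzn // -exprnP.
  by rewrite rmorphM rmorphXn.
rewrite sum_even_odd big_split /= rmorphD; congr (_ + _).
  rewrite (@bin_sumE _ _ n.+2) ?rmorph_sum; last by lia.
  apply: eq_bigr => j _; rewrite /F mulKn //; apply: term; lia.
rewrite (@bin_sumE _ _ n.+2) ?rmorph_sum; last by lia.
apply: eq_bigr => j _; rewrite /F (_ : (2 * j).+1 %/ 2 = j)%N; last by lia.
by rewrite subSS; apply: term; lia.
Qed.

(** The recurrence reduces to [x^2 + x + 1 = 0], hence period 3. The list starts at weight 2, so it
    is rotated against the residues of the weight. *)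
Lemma alt_multisum_trib_shift3 n :
  alt_multisum n.+2 (fun k => trib (k + 3)) = nth 0 [:: 0; 1; -1] (n %% 3).
Proof.
rewrite alt_multisumE; set b := (b in msum _ b).
have rec m : msum m.+4 b = -1 * msum m.+3 b + -1 * msum m.+2 b + 0 * msum m.+1 b.
  by apply: (@msum_trib (-1) 4) => k; rewrite /b addSnnS mulN1r.
apply: (@linrec_eq _ (-1) (-1) 0 (fun n => msum n.+2 b)
  (fun n => nth 0 [:: 0; 1; -1] (n %% 3)) _ _ _ _ _ n) => [m|m|||].
- exact: rec.
- rewrite -[m.+3]addn3 -[m.+2]addn2 -[m.+1]addn1 -!(modnDml m).
  by have := ltn_pmod m (isT : 0 < 3)%N; case: (m %% 3)%N => [|[|[|]]].
- by rewrite msum2.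
- by rewrite msum3.
by rewrite rec msum3 msum2 msum1.
Qed.

Lemma alt_multisum_trib_even2 n :
  alt_multisum n.+3 (fun k => trib (2 * k + 2)) = -4.
Proof.
rewrite alt_multisumE; set b := (b in msum _ b).
have rec m : msum m.+4 b = 1 * msum m.+3 b + 0 * msum m.+2 b + 0 * msum m.+1 b.
  apply: (@msum_trib_skip (-1) 4) => k.
  by rewrite /b mulnS addnAC addnC mulN1r.
by elim: n => [|n IH]; [rewrite msum3 | rewrite rec IH !mul0r].
Qed.

Lemma alt_multisum_trib_odd3 n :
  alt_multisum n.+3 (fun k => trib (2 * k + 3)) = 4 * (-1) ^+ n.+3.
Proof.
rewrite alt_multisumE; set b := (b in msum _ b).
have rec m : msum m.+4 b = -1 * msum m.+3 b + 0 * msum m.+2 b + 0 * msum m.+1 b.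
  apply: (@msum_trib_skip (-1) 5) => k.
  by rewrite /b mulnS addnAC addnC mulN1r.
elim: n => [|n IH]; first by rewrite msum3.
by rewrite rec IH !exprS; ring.
Qed.

(** The lower index is [m - 2 * i] reflected by the symmetry of binomials; being free of
    subtraction, it suits Pascal's rule. *)
Definition bin_diag (m : nat) : int := \sum_(i < m.+1) ('C(m + 1 + i, 3 * i + 1))%:Z.

Lemma bin_diagE m K : (m < 2 * K)%N ->
  bin_diag m = \sum_(i < K) ('C(m + 1 + i, 3 * i + 1))%:Z.
Proof.
pose F i := ('C(m + 1 + i, 3 * i + 1))%:Z.
have F0 i : (m < 2 * i)%N -> F i = 0 by move=> mi; rewrite /F bin_small //; lia.
suff widen K1 K2 : (m < 2 * K1)%N -> (K1 <= K2)%N ->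
    \sum_(i < K1) F i = \sum_(i < K2) F i.
  by move=> mK; case: (leqP K m.+1) => Km; [apply/esym|]; apply: widen; lia.
move=> mK K12; rewrite (big_ord_widen K2 F) // big_mkcond.
by apply: eq_bigr => i _; case: ltnP => // iK; rewrite F0 //; lia.
Qed.

(* The third difference of the [i.+1]-st term, by Pascal's rule, is the [i]-th
   term one step further. *)
Lemma bin_diagSSS m :
  bin_diag m.+3 = 3 * bin_diag m.+2 + -2 * bin_diag m.+1 + 1 * bin_diag m.
Proof.
suff : bin_diag m.+3 - 3 * bin_diag m.+2 + 3 * bin_diag m.+1 - bin_diag m
     = bin_diag m.+1 by lia.
(* The left side gets one term more: its term 0 is linear in [m], so the third difference kills
   it. *)
rewrite [in RHS](@bin_diagE _ m.+2) ?(@bin_diagE _ m.+3); try lia.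
rewrite !mulr_sumr -!sumrN -!big_split big_ord_recl /= !addn0 !bin1.
rewrite (_ : _ + _ + _ - _ = 0) ?add0r; last by lia.
apply: eq_bigr => i _; rewrite /bump add1n mulnS.
rewrite !addnS !addSn !addn0 add0n !binS !PoszD; ring.
Qed.

Lemma sum_upto_bin_diag m :
  sum_upto (m %/ 2)%N%:Z (fun i => ('C(m + 1 + i, m - 2 * i))%:Z) = bin_diag m.
Proof.
rewrite /sum_upto big_mkord (@bin_diagE _ (m %/ 2).+1); last by lia.
apply: eq_bigr => i _; rewrite -bin_sub; last by have := ltn_ord i; lia.
by congr ('C(_, _))%:Z; have := ltn_ord i; lia.
Qed.

(** The alternating sign turns the coefficients 3, -2, 1 of [bin_diagSSS] into -3, -2, -1. *)
Lemma alt_multisum_trib_shift4 n :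
  alt_multisum n.+1 (fun k => trib (k + 4)) = (-1) ^+ n.+1 * bin_diag n.+2.
Proof.
rewrite alt_multisumE; set b := (b in msum _ b).
have rec m : msum m.+4 b = -3 * msum m.+3 b + -2 * msum m.+2 b + -1 * msum m.+1 b.
  by apply: (@msum_trib (-1) 5) => k; rewrite /b addSnnS mulN1r.
apply: (@linrec_eq _ (-3) (-2) (-1) (fun n => msum n.+1 b)
  (fun n => (-1) ^+ n.+1 * bin_diag n.+2) _ _ _ _ _ n) => [m|m|||].
- exact: rec.
- by rewrite (bin_diagSSS m.+2) !exprS; ring.
- by rewrite msum1 /bin_diag !big_ord_recr big_ord0.
- by rewrite msum2 /bin_diag !big_ord_recr big_ord0.
by rewrite msum3 /bin_diag !big_ord_recr big_ord0.
Qed.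

Theorem theorem4 (R : rcfType) (n : nat) (n_ge1 : (1 <= n)%N) :
  (* 1 *)
  ((2 <= n)%N ->
    alt_multisum n (fun k => trib (k - 1)) = - (fib (n - 2))%:Z) /\
  (* 2 *)
  (multisum n (fun k => trib (k - 1)) = ((2 ^ n + 6) %/ 14)%N%:Z) /\
  (* 3 *)
  ((2 <= n)%N ->
    (multisum n (fun k => trib (2 * k - 2)))%:~R =
      (17 + Num.sqrt 17) / 34 * (3 / 2 + Num.sqrt 17 / 2) ^+ (n - 2)
      + (17 - Num.sqrt 17) / 34 * (3 / 2 - Num.sqrt 17 / 2) ^+ (n - 2) :> R) /\
  (* 4 *)
  (alt_multisum n (fun k => trib k) =
    - sum_upto ((n%:Z - 2) %/ 3)%Z (fun i => ('C(n - 2 - 2 * i, i))%:Z)) /\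
  (* 5 *)
  ((2 <= n)%N ->
    multisum n (fun k => trib k) =
      sum_upto ((2 * n%:Z - 4) %/ 3)%Z
        (fun i => ('C(2 * n - 4 - 2 * i, i))%:Z)) /\
  (* 6 *)
  (alt_multisum n (fun k => trib (2 * k - 1)) =
    - Num.floor (4 * 3 ^ (n%:Z - 3) : rat)) /\
  (* 7 *)
  (alt_multisum n (fun k => trib (k + 1)) = - (padovan (n + 2))%:Z) /\
  (* 8 *)
  ((4 <= n)%N -> alt_multisum n (fun k => trib (k + 2)) = 0) /\
  (* 9 *)
  ((alt_multisum n (fun k => trib (2 * k + 1)))%:~R =
    - 2 ^+ (n - 1) *
      \sum_(0 <= i < n)
        2 ^ (- i%:Z - (i %/ 2)%N%:Z) * ('C(n - 1 - i, i %/ 2))%:R :> rat) /\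
  (* 10 *)
  ((2 <= n)%N ->
    [/\ n = 0 %[mod 3] -> alt_multisum n (fun k => trib (k + 3)) = 1,
        n = 1 %[mod 3] -> alt_multisum n (fun k => trib (k + 3)) = -1
      & n = 2 %[mod 3] -> alt_multisum n (fun k => trib (k + 3)) = 0]) /\
  (* 11 *)
  ((3 <= n)%N -> alt_multisum n (fun k => trib (2 * k + 2)) = -4) /\
  (* 12 *)
  (alt_multisum n (fun k => trib (k + 4)) =
    (-1) ^+ n *
      sum_upto ((n + 1) %/ 2)%N%:Z
        (fun i => ('C(n + 2 + i, n + 1 - 2 * i))%:Z)) /\
  (* 13 *)
  ((3 <= n)%N -> alt_multisum n (fun k => trib (2 * k + 3)) = 4 * (-1) ^+ n).
Proof.
case: n n_ge1 => // n _; repeat apply: conj.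
- by case: n => // n _; rewrite alt_multisum_trib_shift1 !subSS subn0.
- exact: multisum_trib_shift1.
- by case: n => // n _; rewrite multisum_trib_even !subSS subn0.
(* At weight 1 the integer quotient of -1 by 3 is -1, so the sum is empty. *)
- case: n => [|n]; first by rewrite alt_multisumE msum1.
  rewrite alt_multisum_trib !subSS subn0 (@sum_upto_bin n) //.
  by rewrite -divz_nat; congr (_ %/ _)%Z; lia.
- case: n => // n _; rewrite multisum_trib.
  rewrite (_ : 2 * n.+2 - 4 = 2 * n)%N; last by lia.
  by rewrite (@sum_upto_bin (2 * n)) // -divz_nat; congr (_ %/ _)%Z; lia.
(* At weights 1 and 2 the exponent of 3 is negative: the floors of 4/9 and 4/3 are 0 and 1. *)
- case: n => [|[|n]]; last by rewrite alt_multisum_trib_odd floor_pow3.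
    by rewrite alt_multisumE msum1 (@floor_def _ _ 0).
  by rewrite alt_multisumE msum2 (@floor_def _ _ 1).
- by rewrite alt_multisum_trib_shift addn2.
- by case: n => [|[|[|n]]] // _; apply: alt_multisum_trib_shift2.
- rewrite mulNr; case: n => [|n].
    by rewrite alt_multisumE msum1 big_nat1 bin0 mulr1.
  by rewrite alt_multisum_trib_odd1 subn1 /= bin_sum_half rmorphN.
- case: n => // n _; rewrite alt_multisum_trib_shift3 -addn2.
  have := ltn_pmod n (isT : 0 < 3)%N; rewrite -(modnDml n).
  by case: (n %% 3)%N => [|[|[|]]].
- by case: n => [|[|n]] // _; apply: alt_multisum_trib_even2.
- rewrite alt_multisum_trib_shift4 -(@sum_upto_bin_diag n.+2) addn1.
  by rewrite !addn1 addn2.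
by case: n => [|[|n]] // _; apply: alt_multisum_trib_odd3.
Qed.
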